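(* Let $k\geq 1$ be an integer and let $d=k^{2}+1$. Then the fundamental solution of the equation $x^{2}-dy^{2}=-1$ is $$x_{1}+y_{1}\sqrt{d}=k+\sqrt{d}.$$
   Context: For a positive integer $d$ that is not a perfect square and a nonzero integer $N$, a pair $(a,b)$ of integers with $a^{2}-db^{2}=N$ is identified with $a+b\sqrt{d}$ and called a solution of $x^{2}-dy^{2}=N$; it is positive if $a>0$ and $b>0$. The fundamental solution of $x^{2}-dy^{2}=N$ is the positive solution $x_{1}+y_{1}\sqrt{d}$ such that $x_{1}+y_{1}\sqrt{d}<x_{2}+y_{2}\sqrt{d}$ for every other positive solution $x_{2}+y_{2}\sqrt{d}$ of the same equation. *)

(* Defs.v *)
(* Stdlib world: integers are Z, real numbers are the classical R. *)
From Stdlib Require Import ZArith Reals.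

Open Scope Z_scope.

Definition nonsquare (d : Z) : Prop := ~ exists m : Z, d = m ^ 2.

Definition pell_solution (d N : Z) (s : Z * Z) : Prop :=
  fst s ^ 2 - d * snd s ^ 2 = N.

Definition positive_solution (d N : Z) (s : Z * Z) : Prop :=
  pell_solution d N s /\ 0 < fst s /\ 0 < snd s.

(* The real number a + b * sqrt d with which the pair (a, b) is identified. *)
Definition pell_value (d : Z) (s : Z * Z) : R :=
  (IZR (fst s) + IZR (snd s) * sqrt (IZR d))%R.

(* The first three conjuncts are the standing assumptions on d and N under
   which the notion is defined; they make the predicate stronger. *)
Definition fundamental_solution (d N : Z) (s : Z * Z) : Prop :=
  0 < d /\ nonsquare d /\ N <> 0 /\
  positive_solution d N s /\
  forall t : Z * Z, positive_solution d N t -> t <> s ->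
    (pell_value d s < pell_value d t)%R.

(* Main.v *)
Require Import Defs.
From Stdlib Require Import ZArith Reals.
From Stdlib Require Import Lia.

Open Scope Z_scope.

(** The pair (k, 1) is a solution because k^2 - (k^2 + 1) = -1.  It is minimal
    because both of its coordinates are minimal: a positive solution (a, b) has
    b >= 1, hence a^2 = d b^2 - 1 >= k^2 and a >= k.  If b = 1, then a = k, so
    any other positive solution has b >= 2, and its value
    a + b sqrt d is strictly larger because sqrt d > 0. *)

(** For k >= 1, k^2 + 1 lies strictly between the consecutive squares
    k^2 and (k + 1)^2. *)
Lemma nonsquare_succ_square (k : Z) : 1 <= k -> nonsquare (k ^ 2 + 1).
Proof.
  intros hk [m hm].
  assert (hm' : k ^ 2 + 1 = Z.abs m ^ 2)
    by (rewrite hm; apply Z.pow_even_abs; now exists 1).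
  assert (k < Z.abs m) by nia.
  nia.
Qed.

Lemma positive_solution_ge (k a b : Z) :
  1 <= k -> positive_solution (k ^ 2 + 1) (-1) (a, b) -> k <= a.
Proof.
  unfold positive_solution, pell_solution; simpl fst; simpl snd.
  intros hk (heq & ha & hb).
  assert (1 <= b ^ 2) by nia.
  nia.
Qed.

Lemma positive_solution_other_gt1 (k a b : Z) :
  1 <= k -> positive_solution (k ^ 2 + 1) (-1) (a, b) -> (a, b) <> (k, 1) ->
  1 < b.
Proof.
  unfold positive_solution, pell_solution; simpl fst; simpl snd.
  intros hk (heq & ha & hb) hne.
  destruct (Z.eq_dec b 1) as [-> | hb1]; [ | lia].
  exfalso; apply hne; f_equal; nia.
Qed.

Lemma pell_value_lt (d a b a' b' : Z) :
  0 < d -> a <= a' -> b < b' ->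
  (pell_value d (a, b) < pell_value d (a', b'))%R.
Proof.
  intros hd ha hb; unfold pell_value; simpl fst; simpl snd.
  apply Rplus_le_lt_compat.
  - now apply IZR_le.
  - apply Rmult_lt_compat_r.
    + now apply sqrt_lt_R0, IZR_lt.
    + now apply IZR_lt.
Qed.

Theorem corollary6 (k d : Z) (hk : 1 <= k) (hd : d = k ^ 2 + 1) :
  fundamental_solution d (-1) (k, 1).
Proof.
  subst d.
  assert (hpos : 0 < k ^ 2 + 1) by nia.
  split; [exact hpos | ].
  split; [now apply nonsquare_succ_square | ].
  split; [lia | ].
  split.
  - unfold positive_solution, pell_solution; simpl fst; simpl snd; lia.
  - intros [a b] ht hne.
    apply pell_value_lt.
    + exact hpos.
    + now apply positive_solution_ge with b.
    + now apply positive_solution_other_gt1 with k a.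
Qed.
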